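(* Fix integers $n\geq 8$, $f\geq 0$, $d\geq 2$ and $k\geq 1$. Then there exists a finite simple non-complete connected graph $G$ on the vertex set $[n]=\{1,\ldots,n\}$ with $f(G)+\operatorname{diam}(G)+\kappa(G)=n+2$ and $(f(G),\operatorname{diam}(G),\kappa(G))=(f,d,k)$ if and only if $f+d+k=n+2$ and one of the following conditions is satisfied: (1) $f\geq 2$, $k\geq 1$ and $d=2$; (2) $f\geq 2$, $k=1$ and $d\geq 2$.
   Context: For a finite simple connected graph $G$ on $[n]$: the distance of two distinct vertices is the smallest length (number of edges) of a path in $G$ connecting them, and $\operatorname{diam}(G)$ is the maximum of all such distances. $\kappa(G)$ denotes the vertex connectivity: for non-complete $G$, the smallest cardinality of a subset $T\subset[n]$ such that the induced subgraph of $G$ on $[n]\setminus T$ is disconnected. A vertex $i$ is free (simplicial) if whenever $\{i,j\},\{i,j'\}\in E(G)$ with $j\neq j'$, then $\{j,j'\}\in E(G)$. $f(G)$ denotes the number of free vertices of $G$. *)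

(* Defs.v *)
From mathcomp Require Import all_boot.

Set Implicit Arguments.
Unset Strict Implicit.
Unset Printing Implicit Defensive.

Record sgraph (V : finType) := SGraph {
  adj :> rel V;
  adj_sym : symmetric adj;
  adj_irr : irreflexive adj }.

(* The least m < b satisfying P, or b if there is none. *)
Definition least_below (b : nat) (P : pred nat) : nat := find P (iota 0 b).

Section Invariants.
Variables (V : finType) (G : sgraph V).

Definition complete : bool := [forall x, forall y, (x != y) ==> G x y].

(* On the empty set this holds vacuously, so the empty graph does not count as
   disconnected. *)
Definition induced_connected (S : {set V}) : bool :=
  [forall x in S, forall y in S,
     connect [rel u v | [&& u \in S, v \in S & G u v]] x y].

Definition connected : bool := (0 < #|V|) && induced_connected [set: V].

(* The vertices of the path are x :: p, so its number of edges is the size of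
   p, which is always smaller than #|V|. The value is #|V| when no path from x
   to y exists, which cannot occur in a connected graph. *)
Definition dist (x y : V) : nat :=
  least_below #|V| (fun m =>
    [exists p : m.-tuple V, [&& path G x p, uniq (x :: p) & last x p == y]]).

Definition diam : nat := \max_(x : V) \max_(y : V | x != y) dist x y.

(* A disconnecting set omits at least two vertices, so the bound #|V| is
   attained only when there is no such set, that is, when G is complete. *)
Definition kappa : nat :=
  least_below #|V| (fun m =>
    [exists T : {set V}, (#|T| == m) && ~~ induced_connected (~: T)]).

Definition free_vertex (i : V) : bool :=
  [forall j, forall j', [&& G i j, G i j' & j != j'] ==> G j j'].

Definition nfree : nat := #|[set i | free_vertex i]|.

End Invariants.

(* Main.v *)
(** Let [x], [y] realise the diameter [d]. A path of minimal length has no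
    interior free vertex, so for [0 < i < d] the non-free vertices at distance
    [i] from [x] already separate [x] from [y]; there are at least [kappa] of
    them. Hence at least [(d - 1) * kappa] non-free vertices differ from [x]
    and [y], and comparing with [n - f = d + k - 2] forces [d = 2] or [k = 1],
    with [x] and [y] both free. The converse is witnessed by the join of a
    [k]-clique with isolated vertices and by a path with extra leaves. *)

Require Import Defs.
From mathcomp Require Import all_boot zify.

Set Implicit Arguments.
Unset Strict Implicit.
Unset Printing Implicit Defensive.

(** * Bounded search, index intervals, and heights along walks *)

Lemma least_below_le b (P : pred nat) m : P m -> least_below b P <= m.
Proof.
move=> Pm; case: (ltnP m b) => [mb|bm].
  rewrite leqNgt; apply/negP => /(before_find 0).
  by rewrite nth_iota // add0n Pm.
(* Here [m] is at least [b], and the search never exceeds its default [b]. *)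
by apply: leq_trans (find_size _ _) _; rewrite size_iota.
Qed.

Lemma least_belowP b (P : pred nat) m :
  m < b -> P m -> P (least_below b P).
Proof.
move=> mb Pm; have hasP : has P (iota 0 b).
  by apply/hasP; exists m; rewrite ?mem_iota.
have := nth_find 0 hasP; rewrite nth_iota ?add0n //.
by move: hasP; rewrite has_find size_iota.
Qed.

Lemma card_ord_interval n a b :
  b <= n -> #|[set i : 'I_n | a <= i < b]| = b - a.
Proof.
move=> bn; rewrite -sum1dep_card -(big_mkord (fun i => a <= i < b) (fun=> 1)).
rewrite -[RHS]muln1 -sum_nat_const_nat.
by rewrite (big_nat_widenl a 0) // (big_nat_widen 0 b n).
Qed.

Lemma path_lipschitz (V : eqType) (e : rel V) (h : V -> nat) x p :
  (forall u v, e u v -> h v <= (h u).+1) ->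
  path e x p -> h (last x p) <= h x + size p.
Proof.
move=> eh; elim: p x => [|z p IHp] x /=; first by rewrite addn0.
by case/andP=> /eh xz /IHp; lia.
Qed.

(** A height that rises by at most one per edge cannot skip a value. With the distance from a vertex
    as height, a walk must meet every intermediate level. *)
Lemma path_intermediate_value (V : eqType) (e : rel V) (h : V -> nat) x p i :
  (forall u v, e u v -> h v <= (h u).+1) ->
  path e x p -> h x < i <= h (last x p) -> exists2 z, z \in p & h z = i.
Proof.
move=> eh; elim: p x => [|z p IHp] x /=; first by lia.
case/andP=> /eh xz zp hi; case: (ltnP (h z) i) => zi.
  have [|w wp hw] := IHp z zp; first by lia.
  by exists w => //; rewrite inE wp orbT.
by exists z; [rewrite mem_head | lia].
Qed.

(** * Connectedness of induced subgraphs *)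

Section Invariants.
Variables (V : finType) (G : sgraph V).

Local Notation restricted S := [rel u v | [&& u \in S, v \in S & G u v]].

Lemma induced_connectedP (S : {set V}) :
  reflect {in S &, forall x y, connect (restricted S) x y}
          (induced_connected G S).
Proof.
apply: (iffP forall_inP) => [H x y xS yS|H x xS].
  by have /forall_inP := H x xS; apply.
by apply/forall_inP => y yS; apply: H.
Qed.

Lemma connectedP :
  connected G <-> 0 < #|V| /\ forall x y, connect G x y.
Proof.
have E : restricted [set: V] =2 G by move=> u v; rewrite /= !inE.
split=> [/andP[V0 /induced_connectedP H]|[V0 H]].
  by split=> // x y; rewrite -(eq_connect E) H ?inE.
by apply/andP; split=> //; apply/induced_connectedP => x y _ _; rewrite (eq_connect E).
Qed.

Lemma isolated_not_induced_connected (S : {set V}) x y :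
  x \in S -> y \in S -> x != y -> {in S, forall z, ~~ G x z} ->
  ~~ induced_connected G S.
Proof.
move=> xS yS xy xiso; apply/negP => /induced_connectedP /(_ x y xS yS).
case/connectP=> [[|z p] /= zp Ey]; first by rewrite Ey eqxx in xy.
by case/andP: zp => /and3P[_ /xiso /negP].
Qed.

(** * Distance and diameter *)

Lemma dist_le x p : path G x p -> dist G x (last x p) <= size p.
Proof.
(* [dist] admits only simple paths; cutting the loops out of a walk yields a simple path of at most
   the same length. *)
move=> xp; case/shortenP: xp => q xq uq qp.
have uq' : uniq q by case/andP: uq.
apply: leq_trans (uniq_leq_size uq' qp).
apply: least_below_le; apply/existsP; exists (in_tuple q).
by apply/and3P.
Qed.

Lemma dist_path x y : connected G ->
  exists p, [/\ path G x p, last x p = y & size p = dist G x y].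
Proof.
case/connectedP=> _ /(_ x y) /connectP[p0 /shortenP[q xq uq _] ->].
(* A simple path has fewer edges than there are vertices, so the search succeeds before reaching its
   default. *)
have qV : size q < #|V|.
  by have := max_card (mem (x :: q)); rewrite (card_uniqP uq).
have /existsP[t /and3P[xt _ /eqP lt]] := least_belowP qV (P := fun m =>
    [exists p : m.-tuple V,
      [&& path G x p, uniq (x :: p) & last x p == last x q]])
  ltac:(by apply/existsP; exists (in_tuple q); apply/and3P).
by exists t; split=> //; rewrite size_tuple.
Qed.

Lemma dist_adj x u v : connected G -> G u v -> dist G x v <= (dist G x u).+1.
Proof.
move=> /(dist_path x u)[p [xp lp <-]] uv.
have := @dist_le x (rcons p v); rewrite rcons_path last_rcons size_rcons.
by apply; rewrite xp lp.
Qed.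

Lemma distxx x : dist G x x = 0.
Proof. by apply/eqP; rewrite -leqn0; apply: (@dist_le x [::]). Qed.

Lemma dist_le_diam x y : x != y -> dist G x y <= diam G.
Proof.
by move=> xy; apply: (bigmax_sup x) => //; apply: (bigmax_sup y).
Qed.

Lemma diam_leP m :
  (forall x y, x != y -> dist G x y <= m) -> diam G <= m.
Proof.
by move=> H; apply/bigmax_leqP => x _; apply/bigmax_leqP => y /H.
Qed.

Lemma diam_attained : 0 < diam G ->
  exists x y, x != y /\ dist G x y = diam G.
Proof.
move=> d0.
case: (boolP [exists x, exists y, (x != y) && (dist G x y == diam G)]).
  by case/existsP=> x /existsP[y /andP[xy /eqP <-]]; exists x, y.
move=> /existsPn H; suff : diam G <= (diam G).-1 by lia.
apply: diam_leP => x y xy; have := dist_le_diam xy.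
by have /existsPn /(_ y) := H x; rewrite xy /=; lia.
Qed.

(** * Vertex connectivity *)

Lemma kappa_le (T : {set V}) :
  ~~ induced_connected G (~: T) -> kappa G <= #|T|.
Proof.
by move=> nT; apply: least_below_le; apply/existsP; exists T; rewrite eqxx.
Qed.

Lemma kappaE (T : {set V}) :
  ~~ induced_connected G (~: T) ->
  (forall T' : {set V}, #|T'| < #|T| -> induced_connected G (~: T')) ->
  kappa G = #|T|.
Proof.
(* Deleting all vertices leaves the empty set, connected by convention; so [T] is proper and its
   size lies in the search range. *)
move=> nT minT; have TV : #|T| < #|V|.
  rewrite -cardsT proper_card // properT; apply: contra nT => /eqP ->.
  by apply/induced_connectedP => x y; rewrite setCT inE.
have /existsP[T' /andP[/eqP cT' nT']] := least_belowP TV (P := fun m =>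
    [exists T0 : {set V}, (#|T0| == m) && ~~ induced_connected G (~: T0)])
  ltac:(by apply/existsP; exists T; rewrite eqxx).
apply/eqP; rewrite eqn_leq kappa_le //= leqNgt; apply: contra nT' => lt.
by apply: minT; rewrite cT'.
Qed.

(** * Free vertices *)

Lemma free_vertexP i :
  reflect (forall j j', G i j -> G i j' -> j != j' -> G j j')
          (free_vertex G i).
Proof.
apply: (iffP forallP) => [H j j' ij ij' jj'|H j].
  by have /forallP/(_ j')/implyP := H j; apply; rewrite ij ij' jj'.
by apply/forallP => j'; apply/implyP => /and3P[]; apply: H.
Qed.

Lemma nfree_nonfree : nfree G + #|[set i | ~~ free_vertex G i]| = #|V|.
Proof.
rewrite -(cardsC [set i | free_vertex G i]); congr (_ + #|pred_of_set _|).
by apply/setP => i; rewrite !inE.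
Qed.

(** The two path neighbours of a free vertex are equal or adjacent, so that vertex can be bypassed
    inside [S]. Each bypass shortens the path, hence the induction on its length. *)
Lemma induced_path_nonfree (S : {set V}) x p :
  path (restricted S) x p ->
  exists q, [/\ path (restricted S) x q, last x q = last x p
    & {in q, forall v, v != last x q -> ~~ free_vertex G v}].
Proof.
have [m] := ubnP (size p); elim: m p => // m IHm p /ltnSE pm xp.
case: (boolP [exists v in [set v in p],
                (v != last x p) && free_vertex G v]); last first.
  move/exists_inPn=> H; exists p; split=> // v vp vl.
  by have := H v; rewrite inE vp vl => /(_ isT).
case/exists_inP=> v; rewrite inE => vp /andP[vl /free_vertexP vfree].
case/splitPr: p / vp => p1 [|w p2] in pm xp vl *.
  by rewrite last_cat eqxx in vl.
move: xp; rewrite cat_path /= => /and4P[xp1 /and3P[uS vS uv] /and3P[_ wS vw] wp2].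
move: pm; rewrite size_cat /= => pm; rewrite last_cat /=.
(* If the neighbours [last x p1] and [w] of [v] coincide, both [v] and [w] are dropped; otherwise
   freeness of [v] gives an edge that skips [v] alone. *)
have [uw|uw] := eqVneq (last x p1) w.
  have [||q [xq lq qfree]] := IHm (p1 ++ p2).
  - by rewrite size_cat; lia.
  - by rewrite cat_path xp1 uw.
  by exists q; rewrite lq last_cat uw in qfree *.
have [||q [xq lq qfree]] := IHm (p1 ++ w :: p2).
- by rewrite size_cat /=; lia.
- rewrite cat_path xp1 /= uS wS wp2 !andbT /=.
  by apply: vfree => //; rewrite adj_sym.
by exists q; rewrite lq last_cat in qfree *.
Qed.

(** * Distance levels and the extremal bound *)

Definition nonfree_level x i := [set v | ~~ free_vertex G v & dist G x v == i].

(** A path from [x] to [y] avoiding the level could be rid of its free interior vertices. It would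
    still meet a vertex at distance [i], which is not [y], hence is non-free and belongs to the
    level. *)
Lemma nonfree_level_separates x y i :
  connected G -> 0 < i < dist G x y ->
  ~~ induced_connected G (~: nonfree_level x i).
Proof.
move=> cG /andP[i0 iy]; set S := ~: _; apply/negP => /induced_connectedP.
move=> /(_ x y); rewrite /S !inE distxx (gtn_eqF iy) (ltn_eqF i0) !andbF.
case/(_ isT isT)/connectP=> p0 /induced_path_nonfree[p [xp <- pfree]] Ey.
have SG u v : restricted S u v -> dist G x v <= (dist G x u).+1.
  by case/and3P=> _ _; apply: dist_adj.
have [|z zp zi] := path_intermediate_value (i := i) SG xp.
  by rewrite distxx i0 -Ey ltnW.
have zS : z \in S.
  by case/splitPr: zp xp => p1 p2; rewrite cat_path => /and3P[_ /and3P[]].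
have zl : z != last x p.
  by apply: contraTneq iy => zl; rewrite Ey -zl zi ltnn.
by move: zS; rewrite !inE (pfree z zp zl) zi eqxx.
Qed.

(** Levels at different distances are disjoint, and each of the first [m] is a separating set. *)
Lemma card_interior_nonfree x y m :
  connected G -> m < dist G x y ->
  m * kappa G <= #|[set v | ~~ free_vertex G v & 0 < dist G x v <= m]|.
Proof.
move=> cG; elim: m => // m IHm my.
have sep : 0 < m.+1 < dist G x y by [].
have := leq_add (kappa_le (nonfree_level_separates cG sep)) (IHm (ltnW my)).
rewrite mulSn -cardsUI => /leq_trans; apply.
set A := _ :|: _; set B := _ :&: _; suff -> : B = set0.
  rewrite cards0 addn0; apply: subset_leq_card; apply/subsetP => v.
  by rewrite !inE; case: free_vertex => //=; lia.
by apply/setP => v; rewrite !inE; case: free_vertex => //=; lia.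
Qed.

(** The interior levels contain neither [x], at distance 0, nor [y], beyond the last level; each of
    the two therefore adds one when it is non-free. *)
Lemma card_nonfree x y : connected G -> x != y ->
  (dist G x y).-1 * kappa G + ~~ free_vertex G x + ~~ free_vertex G y
    <= #|[set v | ~~ free_vertex G v]|.
Proof.
move=> cG xy; set N := [set v | _]; set m := (dist G x y).-1.
have d0 : 0 < dist G x y.
  case: (dist_path x y cG) => [[|z p] [_ /= Ey <-] //].
  by rewrite Ey eqxx in xy.
have W := card_interior_nonfree cG (m := m) (x := x) (y := y) ltac:(lia).
set w := [set v | _ & _] in W.
rewrite (cardsD1 x) (cardsD1 y) !inE (eq_sym y) xy /=.
suff : #|w| <= #|(N :\ x) :\ y| by lia.
apply: subset_leq_card; apply/subsetP => v.
rewrite !inE => /andP[-> /andP[v0 vm]]; rewrite andbT.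
apply/andP; split; first by apply: contraTneq vm => ->; lia.
by apply: contraTneq v0 => ->; rewrite distxx.
Qed.

Lemma extremal_invariants :
  connected G -> 2 <= diam G -> 1 <= kappa G ->
  nfree G + diam G + kappa G = #|V| + 2 ->
  2 <= nfree G /\ (diam G = 2 \/ kappa G = 1).
Proof.
move=> cG d2 k1 E; have [x [y [xy dxy]]] := diam_attained (ltnW d2).
have := card_nonfree cG xy; rewrite dxy; have := nfree_nonfree.
set N := #|_| => EN leN.
have : (diam G).-1 * kappa G <= diam G + kappa G - 2 by lia.
(* With [d] and [k] for diameter and connectivity, the left side of [le1] exceeds the right by
   [(d - 2) * (k - 1)], so a factor vanishes. *)
move=> le1; have dk : diam G = 2 \/ kappa G = 1 by nia.
(* Equality in the bound leaves no room for a non-free [x] or [y]. *)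
split=> //; have E1 : (diam G).-1 * kappa G = diam G + kappa G - 2.
  by case: dk => ->; lia.
have [xfree yfree] : free_vertex G x /\ free_vertex G y.
  by case: (free_vertex G x) (free_vertex G y) leN => [] [] //=; lia.
have <- : #|[set x; y]| = 2 by rewrite cards2 xy.
apply: subset_leq_card; apply/subsetP => v.
by rewrite !inE => /orP[] /eqP ->.
Qed.

End Invariants.

(** * Tools for the witness graphs *)

Lemma nfree_interval n (G : sgraph 'I_n) a b : b <= n ->
  (forall i : 'I_n, free_vertex G i = ~~ (a <= i < b)) ->
  nfree G = n - (b - a).
Proof.
move=> bn freeE; have := nfree_nonfree G; rewrite card_ord.
suff -> : [set i | ~~ free_vertex G i] = [set i : 'I_n | a <= i < b].
  by rewrite card_ord_interval //; lia.
by apply/setP => i; rewrite !inE freeE negbK.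
Qed.

Lemma diam_not_complete (V : finType) (G : sgraph V) :
  2 <= diam G -> ~~ complete G.
Proof.
move=> d2; apply: contraL d2 => /forallP Gc; rewrite -leqNgt.
apply: diam_leP => x y xy; have /forallP/(_ y) := Gc x; rewrite xy /= => Gxy.
by apply: (@dist_le _ G x [:: y]); rewrite /= Gxy.
Qed.

(** * Witness of diameter two *)

Section Join.
Variables n k : nat.

(** The join of the complete graph on the indices below [k] with [n - k] isolated vertices. *)
Definition join_rel (i j : 'I_n) := (i != j) && ((i < k) || (j < k)).
Arguments join_rel i j /.

Lemma join_sym : symmetric join_rel.
Proof. by move=> i j; rewrite /= eq_sym orbC. Qed.

Lemma join_irr : irreflexive join_rel.
Proof. by move=> i; rewrite /= eqxx. Qed.

Definition join_graph := SGraph join_sym join_irr.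

Hypotheses (k0 : 0 < k) (kn : k + 2 <= n).

Let n0 : 0 < n. Proof. by lia. Qed.
(** [u] lies in the clique; [a] and [b], the last two indices, lie outside it because
    [k + 2 <= n]. *)
Let u : 'I_n := Ordinal n0.
Let a_n : n - 2 < n. Proof. by lia. Qed.
Let a : 'I_n := Ordinal a_n.
Let b_n : n - 1 < n. Proof. by lia. Qed.
Let b : 'I_n := Ordinal b_n.
Let ab : a != b. Proof. by rewrite -val_eqE /=; lia. Qed.

Lemma join_short_path i j : i != j ->
  exists2 p, path join_graph i p & last i p = j /\ size p <= 2.
Proof.
move=> ij; case: (boolP (join_graph i j)) => [Gij|].
  by exists [:: j] => //; apply/andP.
rewrite /= ij /= negb_or -!leqNgt => /andP[ki kj].
exists [:: u; j]; rewrite //= -!val_eqE /= k0 orbT; lia.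
Qed.

Lemma join_connected : connected join_graph.
Proof.
apply/connectedP; rewrite card_ord; split=> // i j.
have [->|ij] := eqVneq i j; first exact: connect0.
by have [p ip [<- _]] := join_short_path ij; apply/connectP; exists p.
Qed.

Lemma join_nonadj : ~~ join_graph a b.
Proof. by rewrite /= ab /=; lia. Qed.

Lemma join_diam : diam join_graph = 2.
Proof.
apply/eqP; rewrite eqn_leq; apply/andP; split.
  apply: diam_leP => i j /join_short_path[p ip [<- p2]].
  exact: leq_trans (dist_le ip) p2.
apply: leq_trans (dist_le_diam _ ab).
case: (dist_path a b join_connected) => [[|c [|e p]] [ap lp <-]] //.
  by have := ab; rewrite -lp eqxx.
by have := join_nonadj; rewrite -lp; case/andP: ap => ->.
Qed.

(** A clique vertex sees the non-adjacent pair [a], [b]; any other vertex has all its neighbours in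
    the clique. *)
Lemma join_nfree : nfree join_graph = n - k.
Proof.
rewrite (@nfree_interval _ _ 0 k) ?subn0 //; first by lia.
move=> i /=; case: ltnP => /= ik.
  apply: contraNF join_nonadj => /free_vertexP H.
  by apply: H ab; rewrite /= ik -val_eqE /=; lia.
apply/free_vertexP => j j' /= + + ->; lia.
Qed.

(** Deleting the clique isolates [a]; deleting fewer than [k] vertices spares some clique vertex,
    adjacent to everything left. *)
Lemma join_kappa : kappa join_graph = k.
Proof.
pose T := [set i : 'I_n | 0 <= i < k].
have cT : #|T| = k by rewrite card_ord_interval ?subn0 //; lia.
rewrite -[RHS]cT; apply: kappaE => [|T' ltT].
  apply: (isolated_not_induced_connected (x := a) (y := b)); rewrite ?inE //=.
  - by lia.
  - by lia.
  by move=> z; rewrite !inE /=; lia.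
have [c cT1 cT'] : exists2 c, c \in T & c \notin T'.
  by apply/subsetPn; apply/negP => /subset_leq_card; rewrite leqNgt ltT.
move: cT1; rewrite inE /= => ck.
have cc i : i \notin T' ->
    connect [rel u v | [&& u \in ~: T', v \in ~: T' & join_graph u v]] c i.
  move=> iT'; have [->|ci] := eqVneq c i; first exact: connect0.
  by apply: connect1; rewrite /= !inE iT' cT' ci ck.
apply/induced_connectedP => i j; rewrite !inE => iT' jT'.
apply: connect_trans (cc j jT'); rewrite sym_connect_sym; first exact: cc.
by move=> v w /=; rewrite andbCA eq_sym (orbC (v < k)).
Qed.

End Join.

(** * Witness of connectivity one *)

Section Broom.
Variables n d : nat.

(* The path [0, ..., d] with all further vertices attached to [d - 1]. *)
Definition broom_rel (i j : 'I_n) :=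
  (0 < j) && (i == minn j.-1 d.-1 :> nat)
  || (0 < i) && (j == minn i.-1 d.-1 :> nat).
Arguments broom_rel i j /.

Lemma broom_sym : symmetric broom_rel.
Proof. by move=> i j; rewrite /= orbC. Qed.

Lemma broom_irr : irreflexive broom_rel.
Proof. by move=> i /=; lia. Qed.

Definition broom_graph := SGraph broom_sym broom_irr.

Hypotheses (d2 : 2 <= d) (dn : d < n).

Let n0 : 0 < n. Proof. by lia. Qed.
(** [r] and [l] are the ends of the long path, and [c] is the vertex carrying the leaves. *)
Let r : 'I_n := Ordinal n0.
Let l : 'I_n := Ordinal dn.
Let c_n : d.-1 < n. Proof. by lia. Qed.
Let c : 'I_n := Ordinal c_n.
Let rl : r != l. Proof. by rewrite -val_eqE /=; lia. Qed.

(** In the tree rooted at 0, [minn j d] is the depth of [j], and a vertex [i < d] is an ancestor of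
    every later vertex. *)
Lemma broom_path_up (i j : 'I_n) : i < d -> i <= j ->
  exists2 p, path broom_graph i p & last i p = j /\ size p = minn j d - i.
Proof.
move=> id; have [m] := ubnP (j : nat); elim: m j => // m IHm j jm.
rewrite leq_eqVlt => /orP[/eqP/val_inj <-|ij].
  by exists [::]; split=> //=; lia.
(* The parent of [j]; it is still at least [i] because [i < d]. *)
have pn : minn j.-1 d.-1 < n by have := ltn_ord j; lia.
have [||p ip [lp sp]] := IHm (Ordinal pn); rewrite /=; try lia.
exists (rcons p j); last by rewrite last_rcons size_rcons sp /=; split=> //; lia.
by rewrite rcons_path ip lp /=; lia.
Qed.

Lemma broom_connected : connected broom_graph.
Proof.
apply/connectedP; rewrite card_ord; split=> // i j.
have cr v : connect broom_graph r v.
  have [||p rp [<- _]] := @broom_path_up r v; rewrite //=; first by lia.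
  by apply/connectP; exists p.
apply: connect_trans (cr j); rewrite sym_connect_sym; first exact: cr.
exact: broom_sym.
Qed.

Lemma broom_diam : diam broom_graph = d.
Proof.
apply/eqP; rewrite eqn_leq; apply/andP; split.
  have W (i j : 'I_n) : i < j -> exists2 p, path broom_graph i p
      & last i p = j /\ size p <= d.
    move=> ij; case: (ltnP i d) => id.
      have [p ip [lp sp]] := broom_path_up id (ltnW ij); exists p => //.
      by split=> //; lia.
    (* Two leaves hanging from [c] are joined through [c], in [2 <= d] steps. *)
    by exists [:: c; j] => //=; rewrite andbT; lia.
  apply: diam_leP => i j; rewrite -val_eqE /= neq_ltn => /orP[ij|ji].
    by have [p ip [<- sp]] := W _ _ ij; apply: leq_trans (dist_le ip) sp.
  have [p jp [lp sp]] := W _ _ ji.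
  have ip : path broom_graph i (rev (belast j p)).
    by rewrite -lp rev_path; apply: sub_path jp => v w; rewrite adj_sym.
  have := dist_le ip; rewrite size_rev size_belast.
  suff -> : last i (rev (belast j p)) = j by move/leq_trans; apply.
  by case: (p) lp ji => [/= ->|v q _ _]; rewrite ?ltnn //= rev_cons last_rcons.
apply: leq_trans (dist_le_diam _ rl).
have [p [rp lp <-]] := dist_path r l broom_connected.
(* The depth changes by at most one per edge and goes from 0 at [r] to [d] at [l]. *)
have := @path_lipschitz _ broom_graph (fun i => minn i d) _ p _ rp.
by rewrite lp /= minnn min0n; apply=> v w /=; lia.
Qed.

(** Index 0 and the indices from [d] on have a single neighbour; any [i] in between has the
    non-adjacent neighbours [i.-1] and [i.+1]. *)
Lemma broom_nfree : nfree broom_graph = n - d.-1.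
Proof.
rewrite (@nfree_interval _ _ 1 d) ?subn1 //; first by lia.
move=> i; case: (ltnP 0 i) => i0 /=; last first.
  by apply/free_vertexP => j j'; rewrite -val_eqE /=; lia.
case: (ltnP i d) => id /=; last first.
  by apply/free_vertexP => j j'; rewrite -val_eqE /=; lia.
have pn : i.-1 < n by lia.
have sn : i.+1 < n by lia.
apply/negP => /free_vertexP /(_ (Ordinal pn) (Ordinal sn)).
by rewrite /= -val_eqE /=; lia.
Qed.

(** The only neighbour of [l] is [c], so deleting [c] isolates [l]; a smaller set is empty. *)
Lemma broom_kappa : kappa broom_graph = 1.
Proof.
rewrite -(cards1 c); apply: kappaE => [|T].
  apply: (isolated_not_induced_connected (x := l) (y := r)); rewrite 1?eq_sym //.
  - by rewrite !inE -val_eqE /=; lia.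
  - by rewrite !inE -val_eqE /=; lia.
  by move=> z; rewrite !inE -val_eqE /=; lia.
rewrite cards1 ltnS leqn0 cards_eq0 => /eqP ->; rewrite setC0.
by case/andP: broom_connected.
Qed.

End Broom.

(** * Characterisation of the extremal triples *)

Theorem corollary3p4 (n f d k : nat)
    (hn : 8 <= n) (hf : 0 <= f) (hd : 2 <= d) (hk : 1 <= k) :
  (exists G : sgraph 'I_n,
     [/\ connected G, ~~ complete G,
         nfree G + diam G + kappa G = n + 2
       & (nfree G, diam G, kappa G) = (f, d, k)])
  <->
  (f + d + k = n + 2 /\
   ((2 <= f /\ 1 <= k /\ d = 2) \/
    (2 <= f /\ k = 1 /\ 2 <= d))).
Proof.
split=> [[G [cG _ E [Ef Ed Ek]]]|[E fdk]].
  have := extremal_invariants cG; rewrite card_ord E Ef Ed Ek.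
  move=> /(_ hd hk erefl)[f2 dk]; split; first by rewrite -E Ef Ed Ek.
  by case: dk; [left | right].
suff [G [cG Ef Ed Ek]] : exists G : sgraph 'I_n,
    [/\ connected G, nfree G = f, diam G = d & kappa G = k].
  by exists G; split; rewrite ?diam_not_complete ?Ef ?Ed ?Ek.
case: fdk => [[f2 [k1 d2]]|[f2 [k1 d2]]].
  (* Here [f = n - k], so [2 <= f] gives the required [k + 2 <= n]. *)
  exists (join_graph n k).
  by split; rewrite ?join_connected ?join_nfree ?join_diam ?join_kappa; lia.
(* Here [f = n - d.-1], so [2 <= f] gives the required [d < n]. *)
exists (broom_graph n d).
by split; rewrite ?broom_connected ?broom_nfree ?broom_diam ?broom_kappa; lia.
Qed.
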